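(* Let $(X,Y)$ be a random pair and $(X_i,Y_i)$, $i=1,2,\dots$, independent copies of it. Assume that $\mathbf{E}[X]$, $\mathbf{E}[Y^2]$ and $\mathbf{E}[XY]$ are finite, and that the weight function $w:[0,1]\to\mathbb{R}$ is continuous on $[0,1]$. Then, as $n\to\infty$, $\widehat{\Delta}_n \to \Delta$ almost surely.
   Context: $F_Y$ denotes the cdf of $Y$. The weight function $w:[0,1]\to[-\infty,\infty]$ is finite on $(0,1)$. Standing assumptions: $\mathbf{Var}[Y]\in(0,\infty)$, and $\mathbf{Cov}[Y,w\circ F_Y(Y)]$ is finite and nonzero. The classical beta is $\beta=\mathbf{Cov}[X,Y]/\mathbf{Var}[Y]$. The weighted-Gini beta is $\beta_G=\mathbf{Cov}[X,w\circ F_Y(Y)]/\mathbf{Cov}[Y,w\circ F_Y(Y)]$. Set $\Delta=\beta_G-\beta$. For $n\ge1$, define $\widehat F_Y(y)=\frac{1}{n+1}\sum_{k=1}^n\mathbf{1}\{Y_k\le y\}$ (jumps of size $1/(n+1)$). Let $\overline X=n^{-1}\sum_{k=1}^n X_k$, $\overline Y=n^{-1}\sum_{k=1}^n Y_k$, and $\overline z_0=n^{-1}\sum_{k=1}^n w\circ\widehat F_Y(Y_k)$. Define $\widehat\beta_{G,n}=\frac{\sum_{k=1}^n (X_k-\overline X)(w\circ\widehat F_Y(Y_k)-\overline z_0)}{\sum_{k=1}^n (Y_k-\overline Y)(w\circ\widehat F_Y(Y_k)-\overline z_0)}$, $\widehat\beta_n=\frac{\sum_{k=1}^n (X_k-\overline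 X)(Y_k-\overline Y)}{\sum_{k=1}^n (Y_k-\overline Y)^2}$, and $\widehat\Delta_n=\widehat\beta_{G,n}-\widehat\beta_n$. *)

(* Defs.v *)
From HB Require Import structures.
From mathcomp Require Import all_boot all_order all_algebra.
From mathcomp Require Import all_classical all_reals all_analysis.
Set Implicit Arguments. Unset Strict Implicit. Unset Printing Implicit Defensive.
Import Order.TTheory GRing.Theory Num.Theory.
Import numFieldNormedType.Exports.
Local Open Scope classical_set_scope.
Local Open Scope ring_scope.

Section gini_defs.
Context {d : measure_display} {T : measurableType d} {R : realType}
  (P : probability T R).

Definition rpair (U V : T -> R) : T -> R * R := fun t => (U t, V t).

Definition mutually_independent_pairs (XS YS : nat -> T -> R) : Prop :=
  forall (s : seq nat) (A : nat -> set (R * R)),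
    uniq s -> (forall i, measurable (A i)) ->
    P (\bigcap_(i in [set` s]) (rpair (XS i) (YS i) @^-1` A i)) =
    (\prod_(i <- s) P (rpair (XS i) (YS i) @^-1` A i))%E.

Definition same_joint_law (U' V' U V : T -> R) : Prop :=
  forall A : set (R * R), measurable A ->
    P (rpair U' V' @^-1` A) = P (rpair U V @^-1` A).

(* F_Y as a real-valued function (the library cdf is \bar R-valued but finite). *)
Definition cdfR (Y : {RV P >-> R}) (y : R) : R := fine (cdf Y y).

Definition wFY (w : R -> R) (Y : {RV P >-> R}) : T -> R :=
  fun t => w (cdfR Y (Y t)).

Definition beta_cl (X Y : T -> R) : R :=
  fine (covariance P X Y) / fine (variance P Y).

Definition beta_G (w : R -> R) (X : T -> R) (Y : {RV P >-> R}) : R :=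
  fine (covariance P X (wFY w Y)) / fine (covariance P Y (wFY w Y)).

Definition Delta (w : R -> R) (X : T -> R) (Y : {RV P >-> R}) : R :=
  beta_G w X Y - beta_cl X Y.

End gini_defs.

Section estimators.
Context {T : Type} {R : realType}.
(* Sample indices k = 0, ..., n-1 correspond to the paper's k = 1, ..., n. *)

Definition Fhat (YS : nat -> T -> R) (n : nat) (y : R) (t : T) : R :=
  (n.+1%:R)^-1 * \sum_(k < n) (if YS k t <= y then 1 else 0).

Definition smean (n : nat) (f : nat -> R) : R := (n%:R)^-1 * \sum_(k < n) f k.

Definition zhat (w : R -> R) (YS : nat -> T -> R) (n : nat) (t : T) (k : nat) : R :=
  w (Fhat YS n (YS k t) t).

Definition betaG_hat (w : R -> R) (XS YS : nat -> T -> R) (n : nat) (t : T) : R :=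
  let Xb := smean n (fun k => XS k t) in
  let Yb := smean n (fun k => YS k t) in
  let z0 := smean n (zhat w YS n t) in
  (\sum_(k < n) (XS k t - Xb) * (zhat w YS n t k - z0)) /
  (\sum_(k < n) (YS k t - Yb) * (zhat w YS n t k - z0)).

Definition beta_hat (XS YS : nat -> T -> R) (n : nat) (t : T) : R :=
  let Xb := smean n (fun k => XS k t) in
  let Yb := smean n (fun k => YS k t) in
  (\sum_(k < n) (XS k t - Xb) * (YS k t - Yb)) /
  (\sum_(k < n) (YS k t - Yb) ^+ 2).

Definition Delta_hat (w : R -> R) (XS YS : nat -> T -> R) (n : nat) (t : T) : R :=
  betaG_hat w XS YS n t - beta_hat XS YS n t.

End estimators.

(* Main.v *)
(** The sample covariances of (X, Z) and (Y, Z), with Z_k = w (Fhat (Y_k)), differ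
    from those with Z_k replaced by w (F (Y_k)) by at most
    sup_y |w (Fhat y) - w (F y)| times the sample mean of |X| (resp. |Y|). The
    supremum tends to 0 almost surely by the Glivenko-Cantelli theorem and the
    uniform continuity of w on [0, 1], so the strong law of large numbers applied
    to X, Y, XY, Y^2, |X|, |Y|, w (F Y), X w (F Y), Y w (F Y) gives all the limits.

    The strong law only uses pairwise independence (Etemadi). For Z >= 0 and
    a > 1, truncate all of Z_0, ..., Z_(k_n - 1), k_n = floor (a^n), at the common
    level a^n. The probability that the truncation matters is at most
    a^n P (Z > a^n), the Chebyshev bound for the truncated sum is of order
    a^-n E [Z^2; Z <= a^n], and both are summable because, for each z, the sums
    of a^n over a^n < z and of a^-n z^2 over a^n >= z are O(z). Borel-Cantelli gives
    the convergence along (k_n); monotonicity of the partial sums fills the gaps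
    up to a factor a, and a tends to 1. *)

Require Import Defs.
From HB Require Import structures.
From mathcomp Require Import all_boot all_order all_algebra.
From mathcomp Require Import all_classical all_reals all_analysis.
From mathcomp Require Import measurable_realfun ring lra.
Import Order.TTheory GRing.Theory Num.Theory.
Import numFieldNormedType.Exports.
Local Open Scope classical_set_scope.
Local Open Scope ring_scope.

(** * Independence and variance *)

Definition indep_rv {d} {T : measurableType d} {R : realType}
  (P : probability T R) (U V : T -> R) : Prop :=
  forall A B : set R, measurable A -> measurable B ->
    P (U @^-1` A `&` V @^-1` B) = (P (U @^-1` A) * P (V @^-1` B))%E.

Definition same_law {d} {T : measurableType d} {R : realType}
  (P : probability T R) (U V : T -> R) : Prop :=
  forall A : set R, measurable A -> P (U @^-1` A) = P (V @^-1` A).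

(** Bundles a function known only to be measurable, the form in which [distribution] and [chebyshev]
    take it. *)
Definition mfun_of {d d'} {T : measurableType d} {T' : measurableType d'}
  {f : T -> T'} (mf : measurable_fun setT f) : {mfun T >-> T'} :=
  HB.pack f (isMeasurableFun.Build _ _ _ _ f mf).

Section independence.
Context {d} {T : measurableType d} {R : realType} (P : probability T R).
Implicit Types (U V : T -> R).

Lemma indep_rv_comp {U V : T -> R} {f g : R -> R} : measurable_fun setT f ->
  measurable_fun setT g -> indep_rv P U V -> indep_rv P (f \o U) (g \o V).
Proof.
move=> mf mg iUV A B mA mB.
apply: (iUV (f @^-1` A) (g @^-1` B)).
- by rewrite -(setTI (_ @^-1` _)); exact: mf.
- by rewrite -(setTI (_ @^-1` _)); exact: mg.
Qed.

Lemma same_law_comp {U V} {f : R -> R} : measurable_fun setT f ->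
  same_law P U V -> same_law P (f \o U) (f \o V).
Proof.
move=> mf UV A mA; apply: (UV (f @^-1` A)).
by rewrite -(setTI (_ @^-1` _)); exact: mf.
Qed.

(** Both sides are integrals of [f] against image measures that agree on measurable sets; with [f]
    nonnegative, no integrability is involved. *)
Lemma ge0_expectation_same_law (U V : T -> R) (f : R -> R) :
  measurable_fun setT U -> measurable_fun setT V -> measurable_fun setT f ->
  (forall x, 0 <= f x) -> same_law P U V -> ('E_P[f \o U] = 'E_P[f \o V])%E.
Proof.
move=> mU mV mf f0 UV; rewrite unlock.
have mEf : measurable_fun setT (EFin \o f) by exact/measurable_EFinP.
transitivity (\int[distribution P (mfun_of mU)]_x (f x)%:E)%E.
  by rewrite ge0_integral_distribution//= => y; rewrite lee_fin.
transitivity (\int[distribution P (mfun_of mV)]_x (f x)%:E)%E; last first.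
  by rewrite ge0_integral_distribution//= => y; rewrite lee_fin.
by apply: eq_measure_integral => A mA _; exact: UV.
Qed.

(** The joint law of [(U, V)] agrees with the product of the marginal laws on rectangles, hence
    everywhere; Tonelli then factors the integral. *)
Lemma ge0_expectationM (U V : T -> R) :
  measurable_fun setT U -> measurable_fun setT V -> indep_rv P U V ->
  (forall t, 0 <= U t) -> (forall t, 0 <= V t) ->
  ('E_P[U * V] = 'E_P[U] * 'E_P[V])%E.
Proof.
move=> mU mV iUV U0 V0.
pose W := mfun_of (measurable_fun_pair mU mV).
pose U' := mfun_of mU; pose V' := mfun_of mV.
(* The absolute values make the integrand nonnegative on the whole plane; on the values of [(U, V)]
   it is the plain product. *)
pose f (p : R * R) := (`|p.1| * `|p.2|)%:E.
have mf : measurable_fun setT f.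
  by apply/measurable_EFinP/measurable_funM; exact: measurableT_comp.
have -> : ('E_P[U * V] = \int[distribution P W]_p f p)%E.
  rewrite ge0_integral_distribution//; last first.
    by move=> p; rewrite lee_fin mulr_ge0.
  rewrite unlock; apply: eq_integral => t _ /=.
  by rewrite /f/= !ger0_norm.
rewrite -(@eq_measure_integral _ _ _ _ _
    (distribution P U' \x distribution P V')%E); last first.
  move=> A mA _; apply: product_measure_unique => [B C mB mC|]; last exact: mA.
  exact: (iUV B C mB mC).
rewrite fubini_tonelli1//; last by move=> p; rewrite lee_fin mulr_ge0.
rewrite /fubini_F/=.
pose absE (y : R) : \bar R := `|y|%:E.
have mabsE : measurable_fun setT absE.
  by apply/measurable_EFinP; exact: normr_measurable.
have absE0 y : (0 <= absE y)%E by rewrite lee_fin.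
have EV : ('E_P[V] = \int[distribution P V']_y absE y)%E.
  rewrite (ge0_integral_distribution V' mabsE absE0) unlock.
  by apply: eq_integral => t _; rewrite -[in LHS](ger0_norm (V0 t)).
have EU : ('E_P[U] = \int[distribution P U']_y absE y)%E.
  rewrite (ge0_integral_distribution U' mabsE absE0) unlock.
  by apply: eq_integral => t _; rewrite -[in LHS](ger0_norm (U0 t)).
transitivity (\int[distribution P U']_x (absE x * 'E_P[V]))%E.
  apply: eq_integral => x _.
  under eq_integral do rewrite /f /= EFinM.
  by rewrite ge0_integralZl//= -EV.
by rewrite ge0_integralZr//= ?EU//; exact: expectation_ge0.
Qed.

Lemma bounded_Lfun (U : T -> R) (M p : R) : 0 <= p ->
  measurable_fun setT U ->
  (forall t, `|U t| <= M) -> U \in Lfun P p%:E.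
Proof.
move=> p0 mU UM.
rewrite inE; apply/andP; split; rewrite inE//= /finite_norm unlock poweR_lty//.
apply: (@le_lt_trans _ _ (\int[P]_x (cst (`|M| `^ p)%:E x))%E); last first.
  by apply/integrable_lty => //; exact: finite_measure_integrable_cst.
apply: ge0_le_integral => //.
- by move=> t _; rewrite lee_fin powR_ge0.
- apply/measurable_EFinP; apply: (measurableT_comp (measurable_powR _)) => //.
  exact: measurableT_comp.
- move=> t _; rewrite lee_fin ge0_ler_powR ?nnegrE//.
  exact: le_trans (UM t) (ler_norm M).
Qed.

Lemma variance_sum (U : nat -> T -> R) n :
  (forall i, U i \in Lfun P 2%:E) ->
  (forall i j, i != j -> covariance P (U i) (U j) = 0%E) ->
  ('V_P[fun t => (\sum_(k < n) U k t)%R] = \sum_(k < n) 'V_P[U k])%E.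
Proof.
move=> U2 U0.
have E m : (fun t => \sum_(k < m) U k t) \in Lfun P 2%:E.
  elim: m => [|m IH].
    by under eq_fun do rewrite big_ord0; exact: (@Lfun_cst _ _ _ _ 0).
  under eq_fun do rewrite big_ord_recr/=.
  by apply: rpredD => //; rewrite lee1n.
elim: n => [|n IH].
  rewrite big_ord0; under eq_fun do rewrite big_ord0.
  exact: variance_cst.
rewrite big_ord_recr/= -IH.
under eq_fun do rewrite big_ord_recr/=.
rewrite varianceD//; last exact: E.
(* The bound [m <= n] keeps every index of the sum different from [n]. *)
suff cov0 m : (m <= n)%N ->
    covariance P (fun t => \sum_(k < m) U k t) (U n) = 0%E.
  by rewrite cov0// mule0 adde0.
elim: m => [_|m IHm mn].
  under eq_fun do rewrite big_ord0.
  exact: covariance_cst_l.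
have -> : (fun t => \sum_(k < m.+1) U k t) = (fun t => \sum_(k < m) U k t) \+ U m.
  by apply/funext => t /=; rewrite big_ord_recr.
rewrite covarianceDl// IHm ?(ltnW mn)// U0 ?add0e//.
by rewrite neq_ltn mn.
Qed.

End independence.

(** * Strong law of large numbers *)

Section geometric.
Context {R : realType}.
Implicit Types (a z : R).

Lemma sum_expr_lt a z N : 1 < a -> 0 <= z ->
  \sum_(n < N) (if a ^+ n < z then a ^+ n else 0) <= a / (a - 1) * z.
Proof.
move=> a1 z0; have a10 : 0 < a - 1 by rewrite subr_gt0.
have a0 : 0 < a by apply: lt_trans a1.
rewrite mulrAC ler_pdivlMr//.
(* The telescoping bound by [a ^+ N] carries the induction while [a ^+ N < z] and then yields the
   bound by [a * z]; beyond that point nothing is added to the sum. *)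
suff : (\sum_(n < N) (if a ^+ n < z then a ^+ n else 0)) * (a - 1) <= a ^+ N /\
    (\sum_(n < N) (if a ^+ n < z then a ^+ n else 0)) * (a - 1) <= a * z by case.
elim: N => [|N [IH1 IH2]].
  by rewrite big_ord0 mul0r expr0 ler01 mulr_ge0// ltW.
rewrite big_ord_recr/=; case: ifPn => aNz.
  have aN : a ^+ N.+1 <= a * z by rewrite exprS ler_pM2l// ltW.
  suff : (\sum_(n < N) (if a ^+ n < z then a ^+ n else 0) + a ^+ N) * (a - 1) <=
    a ^+ N.+1 by move=> h; split=> //; exact: le_trans aN.
  rewrite exprS; lra.
rewrite addr0; split => //; apply: (le_trans IH1).
by rewrite ler_weXn2l// ltW.
Qed.

Lemma sum_expr_ge a z N : 1 < a -> 0 < z ->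
  \sum_(n < N) (if a ^+ n < z then 0 else a ^- n) <= a / (a - 1) / z.
Proof.
move=> a1 z0; have a10 : 0 < a - 1 by rewrite subr_gt0.
have a0 : 0 < a by apply: lt_trans a1.
set c := a / (a - 1); have c0 : 0 < c by rewrite divr_gt0.
have cE : c = 1 + c / a by rewrite /c; field; rewrite !gt_eqF.
(* c a^-N is the whole tail of the geometric series from N on. *)
suff : if a ^+ N < z
    then \sum_(n < N) (if a ^+ n < z then 0 else a ^- n) = 0
    else \sum_(n < N) (if a ^+ n < z then 0 else a ^- n) + c * a ^- N <= c / z.
  case: ifPn => [_ ->|_ h]; first by rewrite divr_ge0// ltW.
  by apply: le_trans h; rewrite lerDl mulr_ge0 ?invr_ge0 ?exprn_ge0// ltW.
elim: N => [|N IH].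
  rewrite !big_ord0; case: ifPn => //; rewrite -leNgt expr0 invr1 mulr1 add0r => z1.
  by rewrite ler_pdivlMr// ler_piMr// ltW.
rewrite !big_ord_recr/=; case: ifPn IH => aNz IH.
  rewrite IH !add0r; case: ifPn => //; rewrite -leNgt => zaN.
  by rewrite ler_pM2l// lef_pV2// posrE exprn_gt0.
have -> : a ^+ N.+1 < z = false.
  apply/negbTE; rewrite -leNgt; move: aNz; rewrite -leNgt => /le_trans; apply.
  by rewrite ler_weXn2l// ltW.
(* By [cE], the new term and the new tail add up to the old tail. *)
apply: le_trans IH; rewrite -addrA lerD2l [in leRHS]cE mulrDl mul1r lerD2l.
by rewrite exprS invfM mulrA.
Qed.

(** Used to replace 1 / k_n by 2 / a^n in the Chebyshev bound, where k_n is the integer part of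
    a^n. *)
Lemma truncn_ge_half (x : R) : 1 <= x -> x <= 2 * (Num.truncn x)%:R.
Proof.
move=> x1; have x0 : 0 <= x by apply: le_trans x1.
have := truncnS_gt x; have : 1 <= (Num.truncn x)%:R :> R.
  by rewrite ler1n truncn_gt0.
by rewrite -natr1; lra.
Qed.

End geometric.

(* Values above [b] are replaced by 0, not by [b]. *)
Definition trunc {R : realType} (b z : R) : R := if z <= b then z else 0.

Section truncation.
Context {R : realType}.
Implicit Types b z : R.

Lemma measurable_trunc b : measurable_fun setT (trunc b).
Proof.
by apply: measurable_fun_ifT => //; exact: measurable_fun_ler.
Qed.

Lemma trunc_ge0 b z : 0 <= z -> 0 <= trunc b z.
Proof. by rewrite /trunc; case: ifP. Qed.

Lemma trunc_le b z : 0 <= z -> trunc b z <= z.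
Proof. by rewrite /trunc; case: ifP. Qed.

Lemma normr_trunc_le b z : 0 <= z -> `|trunc b z| <= `|b|.
Proof.
move=> z0; rewrite /trunc; case: ifP => zb; last by rewrite normr0.
by rewrite !ger0_norm// (le_trans z0 zb).
Qed.

End truncation.

Section borel_cantelli.
Context {d} {T : measurableType d} {R : realType} (P : probability T R).

(** First Borel-Cantelli lemma: bounded partial sums make the series finite, so the limsup set is
    null, and outside it the events stop occurring. *)
Lemma ae_eventually_not (F : nat -> set T) (M : R) :
  (forall n, measurable (F n)) ->
  (forall N, \sum_(n < N) P (F n) <= M%:E)%E ->
  {ae P, forall t, \forall n \near \oo, ~ F n t}.
Proof.
move=> mF PF.
have PF0 : P (lim_sup_set F) = 0%E.
  apply: lim_sup_set_cvg0 => //; apply: (@le_lt_trans _ _ M%:E); last exact: ltry.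
  apply: lime_le; first exact: is_cvg_nneseries.
  by apply: nearW => N; rewrite big_mkord.
exists (lim_sup_set F); split => //.
  by apply: bigcap_measurable => // k _; exact: bigcup_measurable.
move=> t /= tF n _; apply: contrapT => nF; apply: tF.
exists n => // m /= nm Fmt; apply: nF; exists m => //.
Qed.

End borel_cantelli.

(** * Moments and deviations of truncated sums *)

Section truncated_sums.
Context {d} {T : measurableType d} {R : realType} (P : probability T R).
Variables (Z : nat -> T -> R) (Z0 : T -> R).
Hypothesis mZ : forall i, measurable_fun setT (Z i).
Hypothesis mZ0 : measurable_fun setT Z0.
Hypothesis Z_ge0 : forall i t, 0 <= Z i t.
Hypothesis Z0_ge0 : forall t, 0 <= Z0 t.
Hypothesis indepZ : forall i j, i != j -> indep_rv P (Z i) (Z j).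
Hypothesis lawZ : forall i, same_law P (Z i) Z0.

Let U b i t := trunc b (Z i t).

Let mU b i : measurable_fun setT (U b i).
Proof. by apply: (measurableT_comp (measurable_trunc b)). Qed.

Let U_Lfun b i (p : R) : 0 <= p -> U b i \in Lfun P p%:E.
Proof.
by move=> p0; apply: (@bounded_Lfun _ _ _ _ _ `|b|) => // t; exact: normr_trunc_le.
Qed.

Let EU b i : ('E_P[U b i] = 'E_P[fun t => trunc b (Z0 t)])%E.
Proof.
(* The absolute value gives a function that is nonnegative on all reals and equals [trunc b] on the
   values of [Z i] and [Z0]. *)
pose f z := `|trunc b z|.
have mf : measurable_fun setT f.
  by apply: measurableT_comp => //; exact: measurable_trunc.
have -> : U b i = f \o Z i.
  by apply/funext => t; rewrite /f /= ger0_norm// trunc_ge0.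
have -> : (fun t => trunc b (Z0 t)) = f \o Z0.
  by apply/funext => t; rewrite /f /= ger0_norm// trunc_ge0.
by apply: ge0_expectation_same_law => // x; exact: normr_ge0.
Qed.

Let EU2 b i : ('E_P[U b i ^+ 2] = 'E_P[fun t => (trunc b (Z0 t) ^+ 2)%R])%E.
Proof.
pose f z := trunc b z ^+ 2.
have mf : measurable_fun setT f.
  by apply: measurable_funX; exact: measurable_trunc.
have -> : U b i ^+ 2 = f \o Z i by [].
have -> : (fun t => trunc b (Z0 t) ^+ 2) = f \o Z0 by [].
by apply: ge0_expectation_same_law => // x; exact: sqr_ge0.
Qed.

Let covU b i j : i != j -> covariance P (U b i) (U b j) = 0%E.
Proof.
move=> ij; rewrite covarianceE ?U_Lfun//; last first.
  by apply: Lfun2_mul_Lfun1; exact: U_Lfun.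
rewrite ge0_expectationM//; first last.
- by move=> t; exact: trunc_ge0.
- by move=> t; exact: trunc_ge0.
- apply: (indep_rv_comp _ (measurable_trunc b) (measurable_trunc b)).
  exact: indepZ.
by rewrite subee// fin_numM// expectation_fin_num// U_Lfun.
Qed.

Let varU b i : ('V_P[U b i] <= 'E_P[fun t => (trunc b (Z0 t) ^+ 2)%R])%E.
Proof.
rewrite varianceE ?U_Lfun// -(EU2 b i).
have := @U_Lfun b i 1 ler01 => /expectation_fin_num/fineK <-.
by rewrite -EFin_expe leeBlDr// leeDl// lee_fin sqr_ge0.
Qed.

Let ESU b n : ('E_P[fun t => (\sum_(i < n) U b i t)%R] =
  (n%:R * fine 'E_P[fun t => trunc b (Z0 t)])%:E)%E.
Proof.
have finE : ('E_P[fun t => trunc b (Z0 t)] \is a fin_num)%E.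
  by rewrite -(EU b 0) expectation_fin_num// U_Lfun.
elim: n => [|n IH].
  by under eq_fun do rewrite big_ord0; rewrite mul0r; exact: expectation_cst.
have -> : (fun t => \sum_(i < n.+1) U b i t) = (fun t => \sum_(i < n) U b i t) \+ U b n.
  by apply/funext => t /=; rewrite big_ord_recr.
rewrite expectationD ?U_Lfun//; last first.
  have -> : (fun t => \sum_(i < n) U b i t) = \sum_(i < n) U b i.
    by apply/funext => t; rewrite fct_sumE.
  by rewrite rpred_sum// => i _; exact: U_Lfun.
by rewrite IH EU -[in X in (_ + X)%E](fineK finE) -EFinD -natr1 mulrDl mul1r.
Qed.

(** Chebyshev's inequality: the covariances vanish, so the variance of the sum is at most [k]
    truncated second moments, and division by (e k)^2 leaves a factor 1 / k. *)
Lemma prob_truncated_sum_dev (b e : R) (k : nat) : 0 < e -> (0 < k)%N ->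
  (P [set t | (e * k%:R <= `|\sum_(i < k) U b i t -
         k%:R * fine 'E_P[fun t => trunc b (Z0 t)]|)%R] <=
   (e ^- 2 / k%:R)%:E * 'E_P[fun t => (trunc b (Z0 t) ^+ 2)%R])%E.
Proof.
move=> e0 k0; have k0' : 0 < k%:R :> R by rewrite ltr0n.
have mS : measurable_fun setT (fun t => \sum_(i < k) U b i t).
  by apply: measurable_sum => i; exact: mU.
have ek0 : 0 < e * k%:R by rewrite mulr_gt0.
have /le_trans : (P [set t | (e * k%:R <= `|\sum_(i < k) U b i t -
       fine 'E_P[fun t => (\sum_(i < k) U b i t)%R]|)%R] <=
    ((e * k%:R) ^- 2)%:E * 'V_P[fun t => (\sum_(i < k) U b i t)%R])%E.
  exact: (chebyshev (mfun_of mS) ek0).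
rewrite ESU/=; apply.
rewrite variance_sum; [|by move=> i; exact: U_Lfun|by move=> i j; exact: covU].
set m := (X in (_ <= _ * X)%E).
have [r r0 mE] : exists2 r, 0 <= r & m = r%:E.
  exists (fine m); first by rewrite fine_ge0//; apply: expectation_ge0 => t; exact: sqr_ge0.
  rewrite fineK// /m -(EU2 b 0) expectation_fin_num//.
  by apply: Lfun2_mul_Lfun1; exact: U_Lfun.
apply: (@le_trans _ _ (((e * k%:R) ^- 2)%:E * \sum_(i < k) r%:E))%E.
  rewrite lee_pmul2l ?fin_numE//; last by rewrite lte_fin invr_gt0 exprn_gt0.
  by apply: lee_sum => i _; rewrite -mE; exact: varU.
rewrite mE sumEFin -!EFinM lee_fin sumr_const card_ord -mulr_natl.
rewrite le_eqVlt; apply/orP; left; apply/eqP; field.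
by rewrite !gt_eqF.
Qed.

(** A union bound over at most [b] events of equal probability. Replacing [k] by [b] gives the
    expectation of b 1{Z0 > b}, which can be summed over b = a^n. *)
Lemma prob_exceed_le (b : R) (k : nat) : (0 <= b) -> k%:R <= b ->
  (P (\big[setU/set0]_(i < k) [set t | (b < Z i t)%R]) <=
   b%:E * P [set t | (b < Z0 t)%R])%E.
Proof.
move=> b0 kb.
have mE (V : T -> R) : measurable_fun setT V -> measurable [set t | b < V t].
  move=> mV; rewrite -[X in measurable X]setTI.
  by have := mV measurableT _ (measurable_itv `]b, +oo[); rewrite preimage_itvoy.
apply: (@le_trans _ _ (\sum_(i < k) P [set t | (b < Z i t)%R])%E).
  by apply: (Boole_inequality P (A := fun i => [set t | b < Z i t])) => i _; exact: mE.
rewrite (eq_bigr (fun=> P [set t | b < Z0 t])); last first.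
  move=> i _; have := lawZ i _ (measurable_itv `]b, +oo[).
  by rewrite !preimage_itvoy.
have Pfin : P [set t | b < Z0 t] \is a fin_num by apply: fin_num_measure; exact: mE.
rewrite -(fineK Pfin) sumEFin sumr_const card_ord -EFinM lee_fin -mulr_natl.
by rewrite ler_wpM2r// fine_ge0.
Qed.

End truncated_sums.

(** The pointwise form of both summability claims: integrated at z = Z0, it bounds the total
    probability of the bad events by a multiple of E[Z0]. *)
Lemma sum_truncation_cost {R : realType} (a K z : R) N : 1 < a -> 0 <= K -> 0 <= z ->
  \sum_(n < N) ((if a ^+ n < z then a ^+ n else 0) + K * (a ^- n * trunc (a ^+ n) z ^+ 2))
  <= (1 + K) * (a / (a - 1)) * z.
Proof.
move=> a1 K0 z0; rewrite big_split/= -mulr_sumr.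
rewrite mulrDl mul1r mulrDl lerD ?sum_expr_lt// -[leRHS]mulrA ler_wpM2l//.
(* [sum_expr_ge] divides by [z], so z = 0 is treated apart. For z > 0 the truncated square is z^2 or
   0, and z^2 times a tail of order 1 / z is of order z. *)
move: z0; rewrite le_eqVlt => /predU1P[<-|z0].
  rewrite mulr0 big1// => i _; rewrite /trunc; case: ifP => _; first by rewrite expr0n mulr0.
  by rewrite expr0n mulr0.
rewrite (eq_bigr (fun n : 'I_N => z ^+ 2 * (if a ^+ n < z then 0 else a ^- n))).
  rewrite -mulr_sumr; apply: (@le_trans _ _ (z ^+ 2 * (a / (a - 1) / z))).
    by rewrite ler_wpM2l ?sqr_ge0 ?sum_expr_ge.
  by rewrite le_eqVlt; apply/orP; left; apply/eqP; field; rewrite !gt_eqF ?subr_gt0.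
move=> n _; rewrite /trunc ltNge; case: ifP => _ /=; first by rewrite mulrC.
by rewrite expr0n !mulr0.
Qed.

(** * Deviations along a geometric subsequence *)

Section geometric_subsequence.
Context {d} {T : measurableType d} {R : realType} (P : probability T R).
Variables (Z : nat -> T -> R) (Z0 : T -> R).
Hypothesis mZ : forall i, measurable_fun setT (Z i).
Hypothesis mZ0 : measurable_fun setT Z0.
Hypothesis Z_ge0 : forall i t, 0 <= Z i t.
Hypothesis Z0_ge0 : forall t, 0 <= Z0 t.
Hypothesis indepZ : forall i j, i != j -> indep_rv P (Z i) (Z j).
Hypothesis lawZ : forall i, same_law P (Z i) Z0.
Hypothesis intZ0 : P.-integrable setT (EFin \o Z0).

(** The centring is still the truncated mean, which varies with [n]; [cvg_expectation_trunc] gives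
    its limit. *)
Lemma ae_geometric_subsequence (a e : R) : 1 < a -> 0 < e ->
  {ae P, forall t, \forall n \near \oo,
    `|\sum_(i < Num.truncn (a ^+ n)) Z i t - (Num.truncn (a ^+ n))%:R *
       fine 'E_P[fun t => trunc (a ^+ n) (Z0 t)]| < e * (Num.truncn (a ^+ n))%:R}.
Proof.
move=> a1 e0; pose k n := Num.truncn (a ^+ n).
have a0 : 0 < a by apply: lt_trans a1.
have an1 n : 1 <= a ^+ n by rewrite exprn_ege1// ltW.
have an0 n : 0 < a ^+ n by rewrite exprn_gt0.
have k0 n : (0 < k n)%N by rewrite truncn_gt0.
have kle n : (k n)%:R <= a ^+ n by rewrite truncn_le// ltW.
(* The bad events: [A n], some variable exceeds the truncation level; [B n], the truncated sum
   deviates from its mean. *)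
pose A n := \big[setU/set0]_(i < k n) [set t | a ^+ n < Z i t].
pose B n := [set t | e * (k n)%:R <= `|\sum_(i < k n) trunc (a ^+ n) (Z i t) -
  (k n)%:R * fine 'E_P[fun t => trunc (a ^+ n) (Z0 t)]|].
have mgt (V : T -> R) b : measurable_fun setT V -> measurable [set t | b < V t].
  move=> mV; rewrite -[X in measurable X]setTI.
  by have := mV measurableT _ (measurable_itv `]b, +oo[); rewrite preimage_itvoy.
have mge (V : T -> R) b : measurable_fun setT V -> measurable [set t | b <= V t].
  move=> mV; rewrite -[X in measurable X]setTI.
  by have := mV measurableT _ (measurable_itv `[b, +oo[); rewrite preimage_itvcy.
have mA n : measurable (A n).
  by apply: bigsetU_measurable => i _; exact: mgt.
have mtr b (V : T -> R) : measurable_fun setT V -> measurable_fun setT (fun t => trunc b (V t)).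
  by move=> mV; apply: (measurableT_comp (measurable_trunc b)).
have mB n : measurable (B n).
  apply: mge; apply: measurableT_comp => //; apply: measurable_funB => //.
  by apply: measurable_sum => i; exact: mtr.
(* The factor [e ^- 2] comes from Chebyshev, the factor 2 from a^n <= 2 k_n. *)
pose K := 2 * e ^- 2.
have K0 : 0 <= K by rewrite mulr_ge0// invr_ge0 sqr_ge0.
pose C := (1 + K) * (a / (a - 1)).
have C0 : 0 <= C.
  by apply: mulr_ge0; [exact: addr_ge0|apply: divr_ge0; rewrite ?subr_ge0 ltW].
(* The integrals of [g1 n] and [g2 n] dominate the probabilities of [A n] and [B n]. Once the sum
   over [n] is taken inside the integral, [sum_truncation_cost] bounds it by [C] times [Z0]. *)
pose g1 n t := (a ^+ n * \1_[set t | a ^+ n < Z0 t] t)%:E.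
pose g2 n t := ((K * a ^- n)%:E * (trunc (a ^+ n) (Z0 t) ^+ 2)%:E)%E.
have g10 n t : (0 <= g1 n t)%E by rewrite lee_fin mulr_ge0// ltW.
have g20 n t : (0 <= g2 n t)%E.
  by rewrite mule_ge0// lee_fin ?sqr_ge0// mulr_ge0// invr_ge0 ltW.
have mg1 n : measurable_fun setT (g1 n).
  by apply/measurable_EFinP/measurable_funM => //; apply: measurable_indic; exact: mgt.
have mtr2 n : measurable_fun setT (fun t => (trunc (a ^+ n) (Z0 t) ^+ 2)%:E).
  by apply/measurable_EFinP; apply: measurable_funX; exact: mtr.
have mg2 n : measurable_fun setT (g2 n) by exact: measurable_funeM.
have PAB n : (P (A n `|` B n) <= \int[P]_t (g1 n t + g2 n t))%E.
  rewrite ge0_integralD//; apply: (le_trans (measureU2 _ (mA n) (mB n))).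
  apply: leeD.
    apply: (le_trans (prob_exceed_le P Z Z0 mZ mZ0 lawZ _ _ (ltW (an0 n)) (kle n))).
    under eq_integral do rewrite /g1 EFinM.
    rewrite ge0_integralZl//; last by rewrite lee_fin ltW.
      rewrite integral_indic//; last exact: mgt.
      by rewrite setIT.
    by apply/measurable_EFinP/measurable_indic; exact: mgt.
  apply: (le_trans (prob_truncated_sum_dev P Z Z0 mZ mZ0 Z_ge0 Z0_ge0 indepZ lawZ _ _ _ e0 (k0 n))).
  rewrite ge0_integralZl//; last 2 first.
    by move=> t _; rewrite lee_fin sqr_ge0.
    by rewrite lee_fin mulr_ge0// invr_ge0 ltW.
  rewrite [in leLHS]unlock; apply: lee_wpmul2r.
    by apply: integral_ge0 => t _; rewrite lee_fin sqr_ge0.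
  rewrite lee_fin /K [2 * _]mulrC -[leRHS]mulrA ler_wpM2l ?invr_ge0 ?sqr_ge0//.
  rewrite ler_pdivlMr// mulrC ler_pdivrMr ?ltr0n//.
  exact: truncn_ge_half.
have : {ae P, forall t, \forall n \near \oo, ~ (A n `|` B n) t}.
  apply: (@ae_eventually_not _ _ _ P _ (C * fine 'E_P[Z0])) => [n|N].
    exact: measurableU.
  apply: (@le_trans _ _ (\sum_(n < N) \int[P]_t (g1 n t + g2 n t))%E).
    by apply: lee_sum => n _; exact: PAB.
  rewrite -ge0_integral_sum//; last 2 first.
    by move=> n; exact: emeasurable_funD.
    by move=> n t _; rewrite adde_ge0.
  apply: (@le_trans _ _ (\int[P]_t (C%:E * (Z0 t)%:E))%E).
    apply: ge0_le_integral => //.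
    - by move=> t _; apply: sume_ge0 => n _; rewrite adde_ge0.
    - by apply: emeasurable_sum => n; exact: emeasurable_funD.
    - by apply: measurable_funeM; exact/measurable_EFinP.
    - move=> t _; have := @sum_truncation_cost _ a K (Z0 t) N a1 K0 (Z0_ge0 t).
      rewrite -lee_fin EFinM; apply: le_trans.
      rewrite -sumEFin; apply: lee_sum => n _.
      rewrite /g1 /g2 -EFinM -EFinD lee_fin -mulrA lerD2r indicE.
      case: ifPn => h; first by rewrite mem_set// mulr1.
      by rewrite memNset ?mulr0//; exact/negP.
  have EZ : (\int[P]_t (Z0 t)%:E \is a fin_num)%E by exact: integrable_fin_num.
  by rewrite integralZl// unlock [in leRHS]EFinM fineK.
apply: filterS => t; apply: filterS => n /not_orP[nA /negP].
rewrite -ltNge.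
(* Off [A n], truncation changes no term of the sum. *)
suff -> : \sum_(i < k n) trunc (a ^+ n) (Z i t) = \sum_(i < k n) Z i t by [].
apply: eq_bigr => i _; rewrite /trunc ifT// leNgt; apply/negP => h; apply: nA.
exact: (@bigsetU_sup _ _ _ (fun j => [set u | a ^+ n < Z j u]) (ltn_ord i) t h).
Qed.

End geometric_subsequence.

(** * From the geometric subsequence to all sample sizes *)

Section interpolation.
Context {R : realType}.
Implicit Types (a c e x : R) (z : nat -> R).

Lemma expr_unbounded a x : 1 < a -> exists n, x < a ^+ n.
Proof.
move=> a1; have a10 : 0 < a - 1 by rewrite subr_gt0.
have bern n : 1 + n%:R * (a - 1) <= a ^+ n.
  elim: n => [|n IH]; first by rewrite mul0r addr0 expr0.
  have : 1 <= a ^+ n by rewrite exprn_ege1// ltW.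
  rewrite exprS -natr1; nra.
exists (Num.truncn (x / (a - 1))).+1; apply: lt_le_trans (bern _).
have := truncnS_gt (x / (a - 1)); rewrite ltr_pdivrMr//; lra.
Qed.

Lemma expr_bracket a x N : 1 < a -> a ^+ N <= x ->
  exists2 n, (N <= n)%N & a ^+ n <= x < a ^+ n.+1.
Proof.
move=> a1 aNx; have ex := expr_unbounded a x a1.
(* The least exponent whose power exceeds [x] is positive, since 1 <= a^N <= x; its predecessor is
   the witness. *)
case: (ex_minnP ex) => [[|n]] xan min.
  suff : x < x by rewrite ltxx.
  by apply: lt_le_trans xan (le_trans _ aNx); rewrite ler_weXn2l// ltW.
exists n; last first.
  rewrite xan andbT leNgt; apply/negP => /min; by rewrite ltnn.
rewrite -ltnS ltnNge; apply/negP => nN.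
have : x < x by apply: (lt_le_trans xan); apply: le_trans aNx; rewrite ler_weXn2l// ltW.
by rewrite ltxx.
Qed.

(** For a^n <= m < a^(n+1), the partial sum at [m] lies between those at k_n and k_(n+1), where k_n
    > m / a - 1 and k_(n+1) <= a m. The term [c / m%:R] pays for the rounding in k_n. *)
Lemma geometric_interpolation a c e z : 1 < a -> 0 < e -> 0 <= c ->
  (forall i, 0 <= z i) ->
  (\forall n \near \oo, `|\sum_(i < Num.truncn (a ^+ n)) z i -
     (Num.truncn (a ^+ n))%:R * c| <= e * (Num.truncn (a ^+ n))%:R) ->
  \forall m \near \oo, (c - e) / a - c / m%:R <= smean m z <= (c + e) * a.
Proof.
move=> a1 e0 c0 z0 [N _ HN].
have a0 : 0 < a by apply: lt_trans a1.
have Sle m n : (m <= n)%N -> \sum_(i < m) z i <= \sum_(i < n) z i.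
  move=> mn; rewrite -(big_mkord predT z) -(big_mkord predT z).
  by rewrite [leRHS](big_cat_nat _ mn)//= lerDl sumr_ge0.
exists (Num.truncn (a ^+ N)).+1 => // m /= Nm.
have aNm : a ^+ N <= m%:R.
  by apply/ltW; apply: lt_le_trans (truncnS_gt _) _; rewrite ler_nat.
have m0 : 0 < m%:R :> R by rewrite ltr0n (leq_trans _ Nm).
have [n Nn /andP[anm man]] := expr_bracket _ _ _ a1 aNm.
have an0 k : 0 <= a ^+ k by rewrite exprn_ge0// ltW.
have kle k : (Num.truncn (a ^+ k))%:R <= a ^+ k by rewrite truncn_le.
have km : (Num.truncn (a ^+ n) <= m)%N.
  by rewrite -(ler_nat R); apply: le_trans anm.
have mk : (m <= Num.truncn (a ^+ n.+1))%N by rewrite truncn_ge_nat// ltW.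
rewrite /smean [m%:R^-1 * _]mulrC; apply/andP; split.
  rewrite ler_pdivlMr// mulrBl divfK ?gt_eqF//.
  apply: le_trans (Sle _ _ km).
  have := HN n Nn; rewrite ler_norml => /andP[+ _].
  set k := Num.truncn _ in km *.
  have : a ^+ n < k%:R + 1 by rewrite natr1; exact: truncnS_gt.
  have : m%:R < a * a ^+ n by rewrite -exprS.
  move=> ma ak Sk.
  (* If c < e the lower bound is at most 0, so nonnegativity of the sum suffices; otherwise c - e
     may multiply inequalities. *)
  have [ce|ce] := leP e c; last first.
    apply: (@le_trans _ _ 0); last by rewrite sumr_ge0.
    rewrite subr_le0; apply: le_trans c0; rewrite mulr_le0_ge0 ?(ltW m0)//.
    by rewrite mulr_le0_ge0 ?invr_ge0 ?(ltW a0)// subr_le0 ltW.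
  have : m%:R / a < k%:R + 1 by apply: lt_trans ak; rewrite ltr_pdivrMr// mulrC.
  rewrite -mulrA [a^-1 * _]mulrC; set q := _ / a => qk.
  have : (c - e) * q <= (c - e) * (k%:R + 1) by rewrite ler_wpM2l ?subr_ge0// ltW.
  lra.
rewrite ler_pdivrMr//; apply: le_trans (Sle _ _ mk) _.
have := HN n.+1 (leq_trans Nn (leqnSn _)); rewrite ler_norml => /andP[_].
have := kle n.+1; set k := _%:R => kan Sk.
apply: (@le_trans _ _ ((c + e) * k)); first by lra.
rewrite -mulrA ler_wpM2l ?addr_ge0 ?(ltW e0)//.
by apply: (le_trans kan); rewrite exprS ler_pM2l.
Qed.

(** One parameter 1 / (j + 1) serves both as excess of the ratio over 1 and as relative error, so
    countably many conditions suffice, as an almost sure statement requires. *)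
Lemma smean_cvg_of_geometric c z : 0 <= c -> (forall i, 0 <= z i) ->
  (forall j, let e : R := j.+1%:R^-1 in \forall n \near \oo,
     `|\sum_(i < Num.truncn ((1 + e) ^+ n)) z i -
     (Num.truncn ((1 + e) ^+ n))%:R * c| <= e * (Num.truncn ((1 + e) ^+ n))%:R) ->
  (fun m => smean m z) @ \oo --> c.
Proof.
move=> c0 z0 H; apply/cvgrPdist_le => eps eps0.
(* As e <= 1, (c + e) (1 + e) <= c + e (c + 2). Below, (c - e) / (1 + e) >= c - e (c + 1), and the
   rounding term costs one more [e] once m >= c / e. So e (c + 2) <= eps is what is wanted. *)
pose j := Num.truncn ((c + 2) / eps).
pose e : R := j.+1%:R^-1.
have e0 : 0 < e by rewrite invr_gt0 ltr0n.
have e1 : e <= 1 by rewrite invf_le1 ?ltr0n// ler1n.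
have ec : e * (c + 2) <= eps.
  rewrite mulrC ler_pdivrMr ?ltr0n// mulrC -ler_pdivrMr//.
  exact/ltW/truncnS_gt.
have a1 : 1 < 1 + e by rewrite ltrDl.
have [M _ HM] := geometric_interpolation _ _ _ _ a1 e0 c0 z0 (H j).
exists (maxn M (Num.truncn (c / e)).+1) => // m /=; rewrite geq_max => /andP[Mm cm].
have m0 : 0 < m%:R :> R by rewrite ltr0n (leq_trans _ cm).
have cme : c / m%:R <= e.
  rewrite ler_pdivrMr// -ler_pdivrMl// mulrC.
  by apply/ltW; apply: lt_le_trans (truncnS_gt _) _; rewrite ler_nat.
have /andP[lo hi] := HM m Mm.
have : c - e * (c + 1) <= (c - e) / (1 + e).
  rewrite ler_pdivlMr; [nra|lra].
rewrite ler_norml => lo'; apply/andP; split; last by lra.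
nra.
Qed.

End interpolation.

(** * Strong law for pairwise independent variables *)

Section strong_law.
Context {d} {T : measurableType d} {R : realType} (P : probability T R).

(** Dominated convergence with bound [Z0]: at each point the truncation is eventually inactive. *)
Lemma cvg_expectation_trunc (Z0 : T -> R) (a : R) : 1 < a ->
  measurable_fun setT Z0 -> (forall t, 0 <= Z0 t) ->
  P.-integrable setT (EFin \o Z0) ->
  (fun n => fine 'E_P[fun t => trunc (a ^+ n) (Z0 t)]) @ \oo --> fine 'E_P[Z0].
Proof.
move=> a1 mZ0 Z00 iZ0.
have fE : ('E_P[Z0] \is a fin_num)%E by rewrite unlock; exact: integrable_fin_num.
apply: fine_cvg; rewrite fineK// unlock.
apply: (@dominated_cvg _ _ _ P setT measurableT _ _ (EFin \o Z0)) => //.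
- move=> n; apply/measurable_EFinP.
  by apply: (measurableT_comp (measurable_trunc _)).
- move=> t _; have [n tan] := expr_unbounded a (Z0 t) a1.
  apply: cvg_near_cst; exists n => // m /= nm; rewrite /trunc ifT//.
  by apply: (le_trans (ltW tan)); rewrite ler_weXn2l// ltW.
- by move=> n t _; rewrite /= lee_fin ger0_norm ?trunc_ge0 ?trunc_le.
Qed.

Lemma slln_ge0 (Z : nat -> T -> R) (Z0 : T -> R) :
  (forall i, measurable_fun setT (Z i)) -> measurable_fun setT Z0 ->
  (forall i t, 0 <= Z i t) -> (forall t, 0 <= Z0 t) ->
  (forall i j, i != j -> indep_rv P (Z i) (Z j)) ->
  (forall i, same_law P (Z i) Z0) ->
  P.-integrable setT (EFin \o Z0) ->
  {ae P, forall t, (fun n => smean n (Z ^~ t)) @ \oo --> fine 'E_P[Z0]}.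
Proof.
move=> mZ mZ0 Z_ge0 Z00 indZ lawZ iZ0.
have c0 : 0 <= fine 'E_P[Z0] by rewrite fine_ge0// expectation_ge0.
pose e j : R := j.+1%:R^-1.
have e0 j : 0 < e j by rewrite invr_gt0 ltr0n.
have a1 j : 1 < 1 + e j by rewrite ltrDl.
(* One half is for the random deviation, the other for the gap between the truncated and the true
   mean. *)
have e20 j : 0 < e j / 2 by rewrite divr_gt0.
have : {ae P, forall t, forall j, \forall n \near \oo,
    `|\sum_(i < Num.truncn ((1 + e j) ^+ n)) Z i t - (Num.truncn ((1 + e j) ^+ n))%:R *
       fine 'E_P[fun t => trunc ((1 + e j) ^+ n) (Z0 t)]| <
       e j / 2 * (Num.truncn ((1 + e j) ^+ n))%:R}.
  by apply/ae_foralln => j; exact: ae_geometric_subsequence.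
apply: filterS => t Ht.
apply: smean_cvg_of_geometric => // j.
have /cvgrPdist_le /(_ _ (e20 j)) := cvg_expectation_trunc Z0 _ (a1 j) mZ0 Z00 iZ0.
apply: filterS2 (Ht j) => n; rewrite -/(e j).
set k := _%:R; set s := \sum_(_ < _) _; set cn := fine _; set c := fine _.
have k0 : 0 <= k by rewrite ler0n.
move=> /ltW h1 h2.
rewrite (_ : s - k * c = (s - k * cn) - k * (c - cn)); last by ring.
apply: (le_trans (ler_normB _ _)).
rewrite normrM (ger0_norm k0).
have := ler_wpM2l k0 h2; lra.
Qed.

(** Positive and negative parts are measurable functions of the variables, so they inherit pairwise
    independence and the common law. *)
Theorem slln (Z : nat -> T -> R) (Z0 : T -> R) :
  (forall i, measurable_fun setT (Z i)) -> measurable_fun setT Z0 ->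
  (forall i j, i != j -> indep_rv P (Z i) (Z j)) ->
  (forall i, same_law P (Z i) Z0) ->
  P.-integrable setT (EFin \o Z0) ->
  {ae P, forall t, (fun n => smean n (Z ^~ t)) @ \oo --> fine 'E_P[Z0]}.
Proof.
move=> mZ mZ0 indZ lawZ iZ0.
pose p (x : R) := Num.max x 0; pose q (x : R) := Num.max (- x) 0.
have mp : measurable_fun setT p by exact: measurable_maxr.
have mq : measurable_fun setT q.
  by apply: measurable_maxr => //; exact: measurableT_comp.
have p0 x : 0 <= p x by rewrite le_max lexx orbT.
have q0 x : 0 <= q x by rewrite le_max lexx orbT.
have pqE x : p x - q x = x.
  by rewrite /p /q; have [x0|x0] := lerP x 0; have [y0|y0] := lerP (- x) 0; lra.
have part (f : R -> R) : measurable_fun setT f -> (forall x, 0 <= f x) ->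
    (forall x, f x <= `|x|) ->
    P.-integrable setT (EFin \o (f \o Z0)) /\
    {ae P, forall t, (fun n => smean n (fun i => f (Z i t))) @ \oo --> fine 'E_P[f \o Z0]}.
  move=> mf f0 fle.
  have ifZ0 : P.-integrable setT (EFin \o (f \o Z0)).
    apply: le_integrable iZ0 => //.
      by apply/measurable_EFinP; exact: measurableT_comp.
    by move=> t _ /=; rewrite lee_fin ger0_norm.
  split => //; apply: slln_ge0 => //.
  - by move=> i; exact: measurableT_comp.
  - exact: measurableT_comp.
  - by move=> t; exact: f0.
  - by move=> i j ij; apply: (indep_rv_comp _ mf mf); exact: indZ.
  - by move=> i; apply: same_law_comp.
have pn x : p x <= `|x| by rewrite /p ge_max ler_norm normr_ge0.
have qn x : q x <= `|x| by rewrite /q ge_max -normrN ler_norm normr_ge0.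
have [ip cp] := part p mp p0 pn.
have [iq cq] := part q mq q0 qn.
have EE : fine 'E_P[Z0] = fine 'E_P[p \o Z0] - fine 'E_P[q \o Z0].
  rewrite -fineB; last 2 first.
    by rewrite unlock; exact: integrable_fin_num.
    by rewrite unlock; exact: integrable_fin_num.
  rewrite -expectationB; last 2 first.
    exact/Lfun1_integrable.
    exact/Lfun1_integrable.
  by congr (fine (expectation _ _)); apply/funext => t /=; rewrite pqE.
apply: filterS2 cp cq => t cp cq; rewrite EE.
have -> : (fun n => smean n (Z ^~ t)) =
    (fun n => smean n (fun i => p (Z i t)) - smean n (fun i => q (Z i t))).
  apply/funext => n; rewrite /smean -mulrBr -sumrB; congr (_ * _).
  by apply: eq_bigr => i _; rewrite pqE.
exact: cvgB.
Qed.

End strong_law.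

(** * Glivenko-Cantelli theorem *)

(** On []-oo, x]] this is the empirical cdf with jumps 1 / n, whereas [Fhat] has jumps 1 / (n +
    1). *)
Definition freq {R : realType} (y : nat -> R) (n : nat) (A : set R) : R :=
  smean n (fun k => \1_A (y k)).

Section frequency.
Context {R : realType}.
Implicit Types (y : nat -> R) (A B : set R).

Lemma freq_ge0 y n A : 0 <= freq y n A.
Proof. by rewrite /freq /smean mulr_ge0 ?invr_ge0// sumr_ge0. Qed.

Lemma freq_le1 y n A : freq y n A <= 1.
Proof.
rewrite /freq /smean; have [->|n0] := eqVneq n 0%N.
  by rewrite big_ord0 mulr0.
rewrite mulrC ler_pdivrMr ?ltr0n ?lt0n// mul1r.
apply: (@le_trans _ _ (\sum_(k < n) 1)); last by rewrite sumr_const card_ord.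
by apply: ler_sum => k _; rewrite indicE; case: (_ \in _).
Qed.

Lemma le_freq y n A B : A `<=` B -> freq y n A <= freq y n B.
Proof.
move=> AB; rewrite /freq /smean ler_wpM2l ?invr_ge0//.
apply: ler_sum => k _; rewrite !indicE.
have [/set_mem/AB Bk|_] := boolP (y k \in A); last by case: (_ \in B).
by rewrite mem_set.
Qed.

(** The deterministic half of Glivenko-Cantelli. [q j] is the quantile of level j / m and [L j]
    stands for the left limit of [F] there, so jumps of [F] do no harm. Monotonicity reduces all [x]
    to finitely many [q j]; the grid and the convergence cost 1 / m each. *)
Lemma uniform_freq (F : R -> R) (q L : nat -> R) (m : nat) y : (0 < m)%N ->
  (forall x, 0 <= F x <= 1) ->
  (forall j, (0 < j < m)%N -> forall x, (j%:R / m%:R <= F x) = (q j <= x)) ->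
  (forall j, (0 < j < m)%N -> L j <= j%:R / m%:R) ->
  (forall j, (0 < j < m)%N -> (fun n => freq y n `]-oo, q j]) @ \oo --> F (q j)) ->
  (forall j, (0 < j < m)%N -> (fun n => freq y n `]-oo, q j[) @ \oo --> L j) ->
  \forall n \near \oo, forall x, `|freq y n `]-oo, x] - F x| <= 2 / m%:R.
Proof.
move=> m0 F01 Fq Lq cF cL.
have m0' : 0 < m%:R :> R by rewrite ltr0n.
have im0 : 0 < m%:R^-1 :> R by rewrite invr_gt0.
have ev (f : nat -> nat -> R) (l : nat -> R) :
    (forall j, (0 < j < m)%N -> f j @ \oo --> l j) ->
    \forall n \near \oo, forall j, (0 < j < m)%N -> `|l j - f j n| <= m%:R^-1.
  move=> fl.
  have : \forall n \near \oo, forall j : 'I_m, (0 < j)%N -> `|l j - f j n| <= m%:R^-1.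
    apply: filter_forall => j.
    have [j0|j0] := posnP j; first by apply: nearW => n; rewrite j0.
    have /cvgrPdist_le /(_ _ im0) : f j @ \oo --> l j by apply: fl; rewrite j0/=.
    by apply: filterS => n.
  by apply: filterS => n H j /andP[j0 jm]; exact: (H (Ordinal jm)).
have := ev _ (fun j => F (q j)) cF; have := ev _ _ cL.
apply: filterS2 => n HL HF x.
have /andP[F0 F1] := F01 x.
(* j / m <= F x < (j + 1) / m, hence q_j <= x < q_(j + 1) *)
pose j := Num.truncn (m%:R * F x).
have mF0 : 0 <= m%:R * F x by rewrite mulr_ge0 ?(ltW m0').
have jle : j%:R / m%:R <= F x.
  by rewrite ler_pdivrMr// mulrC truncn_le.
have jgt : F x < j.+1%:R / m%:R.
  by rewrite ltr_pdivlMr// mulrC truncnS_gt.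
rewrite ler_norml; apply/andP; split.
  (* When F x = 1 the index j is m, for which there is no quantile; m - 1 replaces it. *)
  have [i [im ji]] : exists i, (i < m)%N /\ (i%:R / m%:R <= F x <= i.+1%:R / m%:R).
    have [jm|mj] := ltnP j m; first by exists j; split => //; rewrite jle ltW.
    exists m.-1; rewrite !prednK// divff ?gt_eqF// F1 andbT leqnn; split => //.
    apply: le_trans jle; rewrite ler_pM2r// ler_nat.
    exact: leq_trans (leq_pred _) mj.
  have /andP[iF Fi] := ji.
  have [i0|i0] := posnP i.
    rewrite i0 mul1r in Fi; have := freq_ge0 y n `]-oo, x]; lra.
  have imm : (0 < i < m)%N by rewrite i0.
  have qx : q i <= x by rewrite -Fq.
  have Fqi : i%:R / m%:R <= F (q i) by rewrite Fq.
  have := HF i imm; rewrite ler_norml => /andP[_].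
  have : freq y n `]-oo, q i] <= freq y n `]-oo, x].
    by apply: le_freq; exact: subset_itvl.
  move: Fi; rewrite -natr1 mulrDl mul1r; lra.
move: jle; move: jgt; rewrite -natr1 mulrDl mul1r => jgt jle.
(* In the last cell F x >= 1 - 1 / m, and frequencies are at most 1. *)
have [jm|mj] := ltnP j.+1 m; last first.
  have : 1 <= j.+1%:R / m%:R :> R by rewrite ler_pdivlMr// mul1r ler_nat.
  rewrite -natr1 mulrDl mul1r; have := freq_le1 y n `]-oo, x]; lra.
have jmm : (0 < j.+1 < m)%N by [].
have xq : x < q j.+1 by rewrite ltNge -Fq// -ltNge -natr1 mulrDl mul1r.
have := HL _ jmm; rewrite ler_norml => /andP[+ _].
have := Lq _ jmm; rewrite -natr1 mulrDl mul1r.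
have : freq y n `]-oo, x] <= freq y n `]-oo, q j.+1[.
  by apply: le_freq; exact: subset_itvl.
lra.
Qed.

End frequency.

Section glivenko_cantelli.
Context {d} {T : measurableType d} {R : realType} (P : probability T R).
Variables (Y : {RV P >-> R}) (YS : nat -> {RV P >-> R}).
Hypothesis indY : forall i j, i != j -> indep_rv P (YS i) (YS j).
Hypothesis lawY : forall i, same_law P (YS i) Y.

Lemma ae_freq_cvg (A : set R) : measurable A ->
  {ae P, forall t, (fun n => freq (fun k => YS k t) n A) @ \oo -->
    fine (P (Y @^-1` A))}.
Proof.
move=> mA; have mI : measurable_fun setT (\1_A : R -> R) by exact: measurable_indic.
have mYA : measurable (Y @^-1` A) by rewrite -(setTI (_ @^-1` _)); exact: measurable_funPT.
have EI : \1_A \o Y = \1_(Y @^-1` A) :> (T -> R).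
  by apply/funext => t; rewrite /= !indicE; congr (_%:R); apply/idP/idP; rewrite !inE.
have := @slln _ _ _ P (fun i => \1_A \o YS i) (\1_A \o Y).
rewrite [in X in X -> _]EI expectation_indic//; apply.
- by move=> i; exact: measurableT_comp.
- exact: measurable_indic.
- by move=> i j ij; apply: (indep_rv_comp _ mI mI); exact: indY.
- by move=> i; rewrite -EI; apply: same_law_comp.
- exact: integrable_indic.
Qed.

Lemma cdfR_in01 y : 0 <= cdfR Y y <= 1.
Proof.
by rewrite /cdfR fine_ge0//= -lee_fin fineK ?fin_num_measure//; exact: cdf_le1.
Qed.

Lemma cdfR_nondecreasing : {homo cdfR Y : x y / x <= y}.
Proof.
move=> x y xy; rewrite /cdfR fine_le ?fin_num_measure//.
exact: cdf_nondecreasing.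
Qed.

(** [q] is the infimum of the points where the cdf is at least [u]. The limits of the cdf at both
    infinities make this set nonempty and bounded below, and right continuity puts [q] in it. *)
Lemma quantile_ex (u : R) : 0 < u < 1 -> exists q : R,
  (forall x, (u <= cdfR Y x) = (q <= x)) /\ fine (P (Y @^-1` `]-oo, q[)) <= u.
Proof.
move=> /andP[u0 u1]; pose S := [set x | u <= cdfR Y x].
have cE x : cdf Y x = (cdfR Y x)%:E by rewrite /cdfR fineK// fin_num_measure.
have hiS : S !=set0.
  have /fine_cvg : cdf Y @ +oo --> (1%R)%:E := cvg_cdfy1 Y.
  move=> /cvgrPdist_lt /(_ (1 - u)); rewrite subr_gt0 => /(_ u1) [M [_ HM]].
  exists (M + 1); rewrite /S/=.
  have := HM (M + 1); rewrite ltrDl => /(_ ltr01) /=.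
  rewrite -[fine _]/(cdfR Y (M + 1)) ltr_norml => /andP[_]; lra.
have loS : has_lbound S.
  have /fine_cvg : cdf Y @ -oo --> (0%R)%:E := cvg_cdfNy0 Y.
  move=> /cvgrPdist_lt /(_ u u0) [M [_ HM]].
  exists M => x Sx; rewrite leNgt; apply/negP => xM.
  have := HM x xM; rewrite /= -[fine _]/(cdfR Y x) sub0r normrN.
  rewrite ltNge => /negP; apply; apply: le_trans Sx _.
  exact: ler_norm.
pose q := inf S.
have infS : has_inf S by [].
have Flt x : x < q -> cdfR Y x < u.
  move=> xq; rewrite ltNge; apply/negP => Sx.
  by move: xq; rewrite ltNge => /negP; apply; exact: inf_lbound.
have Fgt x : q < x -> u <= cdfR Y x.
  move=> qx; have [z Sz zx] : exists2 z, S z & z < x by exact: inf_lt.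
  by apply: le_trans Sz _; apply: cdfR_nondecreasing; exact: ltW.
have Fq : u <= cdfR Y q.
  have /fine_cvg c : cdf Y @ q^'+ --> (cdfR Y q)%:E.
    by rewrite -cE; exact: cdf_right_continuous.
  rewrite -(cvg_lim _ c)//; apply: limr_ge; first by apply: cvgP c.
  by near=> x; apply: Fgt; near: x; exact: nbhs_right_gt.
exists q; split.
  move=> x; apply/idP/idP => [Fx|qx].
    by rewrite leNgt; apply/negP => /Flt; rewrite ltNge Fx.
  by apply: le_trans Fq _; exact: cdfR_nondecreasing.
(* Continuity from below along q - 1 / (n + 1), where the cdf is below [u]. *)
pose B n := Y @^-1` `]-oo, q - n.+1%:R^-1].
have mB n : measurable (B n) by rewrite -(setTI (B n)); exact: measurable_funPT.
have UB : Y @^-1` `]-oo, q[ = \bigcup_n B n.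
  apply/seteqP; split => [t /=|t [n _]]; rewrite /B/= !in_itv/=.
    move=> tq; have [n tn] := ltr_add_invr tq.
    by exists n => //; rewrite /B/= in_itv/= lerBrDr ltW.
  by move=> /le_lt_trans; apply; rewrite ltrBlDr ltrDl invr_gt0.
have : P (B n) @[n --> \oo] --> P (Y @^-1` `]-oo, q[).
  rewrite UB; apply: nondecreasing_cvg_mu => //; first exact: bigcup_measurable.
  move=> n m nm; apply/subsetPset => t; rewrite /B/= !in_itv/= => /le_trans; apply.
  by rewrite lerD2l lerN2 lef_pV2 ?posrE// ler_nat.
rewrite -[X in _ --> X]fineK; last first.
  by rewrite fin_num_measure// UB; exact: bigcup_measurable.
move=> /fine_cvg c; rewrite -(cvg_lim _ c)//; apply: limr_le; first exact: cvgP c.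
apply: nearW => n; apply/ltW/Flt.
by rewrite ltrBlDr ltrDl invr_gt0.
Unshelve. all: by end_near. Qed.

Theorem glivenko_cantelli :
  {ae P, forall t, forall e, 0 < e -> \forall n \near \oo,
    forall x, `|freq (fun k => YS k t) n `]-oo, x] - cdfR Y x| <= e}.
Proof.
(* Quantiles are chosen for all pairs (j, m) at once, so that a single null set serves every [e];
   pairs outside 0 < j < m get the dummy value 0. *)
have qE (jm : nat * nat) : exists q : R, (0 < jm.1 < jm.2)%N ->
    (forall x, (jm.1%:R / jm.2%:R <= cdfR Y x) = (q <= x)) /\
    fine (P (Y @^-1` `]-oo, q[)) <= jm.1%:R / jm.2%:R.
  case: jm => j m /=; have [/andP[j0 jm]|] := boolP (0 < j < m)%N; last by exists 0.
  have m0 : 0 < m%:R :> R by rewrite ltr0n (leq_ltn_trans _ jm).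
  have [|q Hq] := @quantile_ex (j%:R / m%:R); last by exists q.
  apply/andP; split; first by apply: divr_gt0 => //; rewrite ltr0n.
  by rewrite ltr_pdivrMr ?mul1r ?ltr_nat.
have [q {}qE] := choice qE.
have : {ae P, forall t, forall m j,
    (fun n => freq (fun k => YS k t) n `]-oo, q (j, m)]) @ \oo --> cdfR Y (q (j, m)) /\
    (fun n => freq (fun k => YS k t) n `]-oo, q (j, m)[) @ \oo -->
      fine (P (Y @^-1` `]-oo, q (j, m)[))}.
  apply/ae_foralln => m; apply/ae_foralln => j.
  have := ae_freq_cvg _ (measurable_itv `]-oo, q (j, m)]).
  have := ae_freq_cvg _ (measurable_itv `]-oo, q (j, m)[).
  by apply: filterS2 => t.
apply: filterS => t H e e0.
pose m := (Num.truncn (2 / e)).+1.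
have m0 : 0 < m%:R :> R by rewrite ltr0n.
have me : 2 / m%:R <= e.
  rewrite ler_pdivrMr// mulrC -ler_pdivrMr//.
  exact/ltW/truncnS_gt.
have := @uniform_freq _ (cdfR Y) (fun j => q (j, m))
  (fun j => fine (P (Y @^-1` `]-oo, q (j, m)[))) m (fun k => YS k t).
case/(_ isT cdfR_in01).
- by move=> j jm x; have [-> _] := qE (j, m) jm.
- by move=> j jm; have [_ ?] := qE (j, m) jm.
- by move=> j jm; have [? _] := H m j.
- by move=> j jm; have [_ ?] := H m j.
move=> N _ HN; exists N => // n Nn x; exact: le_trans (HN n Nn x) me.
Qed.

End glivenko_cantelli.

(** * Consistency of the plug-in estimators *)

Section real_analysis.
Context {R : realType}.

(** Heine's theorem: the near-covering form of compactness turns radii valid near each point into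
    one 1 / (n + 1) valid on the segment. *)
Lemma within_itv_unif_continuous (w : R -> R) (a b e : R) : 0 < e ->
  {within `[a, b], continuous w} ->
  exists2 r : R, 0 < r & forall x y, x \in `[a, b] -> y \in `[a, b] ->
    `|x - y| < r -> `|w x - w y| <= e.
Proof.
move=> e0 cw.
pose Q (n : nat) (x : R) := x \in `[a, b] -> forall y, y \in `[a, b] ->
  `|x - y| < n.+1%:R^-1 -> `|w x - w y| <= e.
have [N _ HN] : \forall n \near \oo, `[a, b] `<=` Q n.
  have /compact_near_coveringP K := @segment_compact R a b.
  apply: K => x xab.
  have /subspace_continuousP/(_ x xab)/cvgrPdist_le := cw.
  have e20 : 0 < e / 2 by rewrite divr_gt0.
  move=> /(_ _ e20); rewrite near_withinE => /nbhs_ballP[r /= r0 Hr].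
  (* Half the radius is for moving the centre from [x] to x', half for the distance from x' to
     [y]. *)
  have r20 : 0 < r / 2 by rewrite divr_gt0.
  exists (ball x (r / 2), [set n | n.+1%:R^-1 < r / 2]).
    split; first exact: nbhsx_ballx.
    exists (Num.truncn (r / 2)^-1) => // n /= Nn.
    rewrite invf_plt ?posrE ?ltr0n//; apply: lt_le_trans (truncnS_gt _) _.
    by rewrite ler_nat.
  move=> [x' n] /= [xx' nr] x'ab y yab x'y.
  have rr : r / 2 <= r by lra.
  have h1 : `|w x - w x'| <= e / 2 := Hr x' (le_ball rr xx') x'ab.
  have bxy : ball x r y.
    rewrite /ball/=; apply: (le_lt_trans (ler_distD x' x y)).
    by rewrite [r]splitr ltrD// (lt_trans x'y).
  have h2 : `|w x - w y| <= e / 2 := Hr y bxy yab.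
  by apply: (le_trans (ler_distD (w x) _ _)); rewrite (distrC (w x')) [e]splitr lerD.
exists N.+1%:R^-1; first by rewrite invr_gt0.
by move=> x y xab yab; apply: (HN N) => //=.
Qed.

Lemma within_itv_bounded (w : R -> R) (a b : R) : a <= b ->
  {within `[a, b], continuous w} ->
  exists M, forall x, x \in `[a, b] -> `|w x| <= M.
Proof.
move=> ab cw; have [c _ Hc] := EVT_max ab cw; have [e _ He] := EVT_min ab cw.
exists (`|w c| + `|w e|) => x xab.
have := Hc x xab; have := He x xab.
have := ler_norm (w c); have := ler_norm (- w e); rewrite normrN.
have := normr_ge0 (w c); have := normr_ge0 (w e).
by rewrite ler_norml => *; apply/andP; split; lra.
Qed.

(** The uncentred form is built from sample means only, so their limits give its limit. *)
Definition sample_cov (n : nat) (x z : nat -> R) : R :=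
  smean n (fun k => x k * z k) - smean n x * smean n z.

Lemma sum_centered_prod (n : nat) (x z : nat -> R) :
  \sum_(k < n) (x k - smean n x) * (z k - smean n z) = n%:R * sample_cov n x z.
Proof.
have [->|n0] := eqVneq n 0%N; first by rewrite big_ord0 mul0r.
have n0' : n%:R != 0 :> R by rewrite pnatr_eq0.
have S (y : nat -> R) : \sum_(k < n) y k = n%:R * smean n y.
  by rewrite /smean mulVKf.
rewrite (eq_bigr (fun k : 'I_n => x k * z k - smean n z * x k
    - smean n x * z k + smean n x * smean n z)); last by move=> k _; ring.
rewrite big_split/= sumr_const card_ord !sumrB -!mulr_sumr (S x) (S z).
rewrite (S (fun k => x k * z k)) /sample_cov -[X in _ + X]mulr_natl; ring.
Qed.

(** The array [z] depends on [n], as the values of [zhat] do. Replacing it by [z'] costs at most the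
    uniform error times the mean of |v|, which stays bounded. *)
Lemma smean_perturb (v z' : nat -> R) (z : nat -> nat -> R) (l m : R) :
  (fun n => smean n (fun k => v k * z' k)) @ \oo --> l ->
  (fun n => smean n (fun k => `|v k|)) @ \oo --> m ->
  (forall e, 0 < e -> \forall n \near \oo, forall k, (k < n)%N ->
     `|z n k - z' k| <= e) ->
  (fun n => smean n (fun k => v k * z n k)) @ \oo --> l.
Proof.
move=> cl cm zz'; apply/cvgrPdist_le => e e0.
(* The mean of |v| is eventually at most |m| + 1, so the replacement costs at most e / 2. *)
pose e' := e / 2 / (`|m| + 1).
have m1 : 0 < `|m| + 1 by rewrite ltr_wpDl.
have e'0 : 0 < e' by rewrite divr_gt0// divr_gt0.
have e20 : 0 < e / 2 by rewrite divr_gt0.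
have /cvgrPdist_le/(_ _ e20) := cl; have /cvgrPdist_le/(_ _ ltr01) := cm.
have := zz' _ e'0.
apply: filterS3 => n Hz Hm Hl.
have : `|smean n (fun k => v k * z n k) - smean n (fun k => v k * z' k)| <=
    e' * smean n (fun k => `|v k|).
  rewrite /smean -mulrBr -sumrB normrM ger0_norm ?invr_ge0// mulrCA.
  rewrite ler_wpM2l ?invr_ge0//; apply: (le_trans (ler_norm_sum _ _ _)).
  rewrite mulr_sumr; apply: ler_sum => k _.
  by rewrite -mulrBr normrM mulrC ler_wpM2r// Hz.
have : smean n (fun k => `|v k|) <= `|m| + 1.
  move: Hm; rewrite ler_norml => /andP[+ _]; have := ler_norm m; lra.
move=> /(ler_wpM2l (ltW e'0)); rewrite /e' divfK ?gt_eqF// -/e'.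
have := ler_distD (smean n (fun k => v k * z' k)) l (smean n (fun k => v k * z n k)).
rewrite (distrC (smean n (fun k => v k * z' k))).
lra.
Qed.

End real_analysis.

(** * Strong law for functions of the pairs *)

Section pairs.
Context {d} {T : measurableType d} {R : realType} (P : probability T R).
Variables (X Y : {RV P >-> R}) (XS YS : nat -> {RV P >-> R}).
Hypothesis indXY : mutually_independent_pairs P (fun i => XS i) (fun i => YS i).
Hypothesis lawXY : forall i, same_joint_law P (XS i) (YS i) X Y.

Let measurable_preimage (g : R * R -> R) A : measurable_fun setT g ->
  measurable A -> measurable (g @^-1` A).
Proof. by move=> mg mA; rewrite -(setTI (_ @^-1` _)); exact: mg. Qed.

Lemma pairwise_indep (g : R * R -> R) i j : measurable_fun setT g -> i != j ->
  indep_rv P (fun t => g (XS i t, YS i t)) (fun t => g (XS j t, YS j t)).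
Proof.
move=> mg ij A B mA mB.
(* Independence is stated for sets indexed by all naturals; only the values at [i] and [j] matter
   here. *)
pose C k := if k == i then g @^-1` A else g @^-1` B.
have mC k : measurable (C k).
  by rewrite /C; case: ifP => _; exact: measurable_preimage.
have uij : uniq [:: i; j] by rewrite /= inE ij.
have := indXY [:: i; j] C uij mC.
rewrite !big_cons big_nil mule1 /C eqxx eq_sym (negbTE ij).
rewrite [X in P X = _ -> _](_ : _ = (fun t => g (XS i t, YS i t)) @^-1` A `&`
  (fun t => g (XS j t, YS j t)) @^-1` B) //.
apply/seteqP; split => [t H|t [HA HB] k].
  split.
    by have := H i; rewrite /= eqxx; apply; rewrite inE eqxx.
  by have := H j; rewrite /= eq_sym (negbTE ij); apply; rewrite !inE eqxx orbT.
by rewrite /= !inE => /orP[/eqP ->|/eqP ->]; rewrite ?eqxx// eq_sym (negbTE ij).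
Qed.

Lemma slln_pair (g : R * R -> R) : measurable_fun setT g ->
  P.-integrable setT (fun t => (g (X t, Y t))%:E) ->
  {ae P, forall t, (fun n => smean n (fun i => g (XS i t, YS i t))) @ \oo -->
    fine 'E_P[fun t => g (X t, Y t)]}.
Proof.
move=> mg ig.
have mgp (U V : {RV P >-> R}) : measurable_fun setT (fun t => g (U t, V t)).
  by apply: (measurableT_comp mg); exact: measurable_fun_pair.
apply: (slln P (fun i t => g (XS i t, YS i t))) => //.
- by move=> i j; exact: pairwise_indep.
- move=> i A mA; exact: (lawXY i (g @^-1` A) (measurable_preimage _ _ mg mA)).
Qed.

End pairs.

(** * Algebra of the estimators *)

Section estimator_identities.
Context {T : Type} {R : realType}.
Implicit Types (w : R -> R) (XS YS : nat -> T -> R) (t : T).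

Lemma sum_centered_ratio (n : nat) (x y z z' : nat -> R) :
  (\sum_(k < n) (x k - smean n x) * (z k - smean n z)) /
  (\sum_(k < n) (y k - smean n y) * (z' k - smean n z')) =
  sample_cov n x z / sample_cov n y z'.
Proof.
(* For n = 0 both sides are 0, because division by 0 gives 0. *)
rewrite !sum_centered_prod; have [->|n0] := eqVneq n 0%N.
  have smean0 (f : nat -> R) : smean 0 f = 0 by rewrite /smean big_ord0 mulr0.
  by rewrite /sample_cov !smean0 mulr0 subr0 !mul0r.
by rewrite -mulf_div divff ?mul1r ?pnatr_eq0.
Qed.

Lemma betaG_hatE w XS YS n t : betaG_hat w XS YS n t =
  sample_cov n (XS ^~ t) (zhat w YS n t) / sample_cov n (YS ^~ t) (zhat w YS n t).
Proof. exact: sum_centered_ratio. Qed.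

Lemma beta_hatE XS YS n t : beta_hat XS YS n t =
  sample_cov n (XS ^~ t) (YS ^~ t) / sample_cov n (YS ^~ t) (YS ^~ t).
Proof.
by rewrite -sum_centered_ratio.
Qed.

Lemma Fhat_freq YS n y t :
  n.+1%:R * Fhat YS n y t = n%:R * freq (YS ^~ t) n `]-oo, y].
Proof.
rewrite /Fhat mulVKf ?pnatr_eq0// /freq /smean.
have [->|n0] := eqVneq n 0%N; first by rewrite !big_ord0 mul0r.
rewrite mulVKf ?pnatr_eq0//; apply: eq_bigr => k _.
rewrite indicE; case: ifPn => h.
  by rewrite mem_set//= in_itv.
by rewrite memNset//= in_itv; exact/negP.
Qed.

Lemma Fhat_in01 YS n y t : 0 <= Fhat YS n y t <= 1.
Proof.
have n1 : 0 < n.+1%:R :> R by rewrite ltr0n.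
apply/andP; split.
  by rewrite -(pmulr_rge0 _ n1) Fhat_freq mulr_ge0 ?freq_ge0.
rewrite -(ler_pM2l n1) mulr1 Fhat_freq; apply: (@le_trans _ _ n%:R).
  by rewrite ler_piMr// freq_le1.
by rewrite ler_nat.
Qed.

(** By [Fhat_freq], n + 1 times the difference is minus the frequency, of absolute value at most
    1. *)
Lemma Fhat_freq_dist YS n y t :
  `|Fhat YS n y t - freq (YS ^~ t) n `]-oo, y]| <= n.+1%:R^-1.
Proof.
have n1 : 0 < n.+1%:R :> R by rewrite ltr0n.
rewrite -(ler_pM2l n1) divff ?gt_eqF// -{1}(ger0_norm (ltW n1)) -normrM mulrBr Fhat_freq.
rewrite -mulrBl -[n.+1%:R]natr1 opprD addNKr mulN1r normrN ger0_norm ?freq_ge0//.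
exact: freq_le1.
Qed.

End estimator_identities.

(** * Integrability and covariances *)

Section moments.
Context {d} {T : measurableType d} {R : realType} (P : probability T R).
Implicit Types U V : T -> R.

Lemma integrableM_bounded U V M : measurable_fun setT V ->
  (forall t, `|V t| <= M) -> P.-integrable setT (EFin \o U) ->
  P.-integrable setT (fun t => (U t * V t)%:E).
Proof.
move=> mV VM iU.
have mU : measurable_fun setT U by apply/measurable_EFinP; exact: measurable_int iU.
apply: (@le_integrable _ _ _ P setT measurableT _ (fun t => M%:E * (U t)%:E)%E).
- by apply/measurable_EFinP; exact: measurable_funM.
- move=> t _; rewrite -EFinM !abse_EFin lee_fin !normrM mulrC ler_wpM2r//.
  exact: le_trans (VM t) (ler_norm M).
- exact: integrableZl.
Qed.

Lemma fine_covarianceE U V : P.-integrable setT (EFin \o U) ->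
  P.-integrable setT (EFin \o V) -> P.-integrable setT (fun t => (U t * V t)%:E) ->
  fine (covariance P U V) = fine 'E_P[fun t => (U t * V t)%R] -
    fine 'E_P[U] * fine 'E_P[V].
Proof.
move=> iU iV iUV.
have fE W : P.-integrable setT (EFin \o W) -> ('E_P[W] \is a fin_num)%E.
  by move=> iW; rewrite unlock; exact: integrable_fin_num.
rewrite covarianceE; [|exact/Lfun1_integrable|exact/Lfun1_integrable|
  exact/Lfun1_integrable].
by rewrite fineB ?fineM ?fE// fin_numM ?fE.
Qed.

End moments.

(** * Replacing the empirical cdf by the true one *)

Section plug_in.
Context {d} {T : measurableType d} {R : realType} (P : probability T R).
Variables (Y : {RV P >-> R}) (YS : nat -> {RV P >-> R}) (w : R -> R).
Hypothesis cw : {within `[0, 1], continuous w}.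

Lemma measurable_wcdf : measurable_fun setT (fun y => w (cdfR Y y)).
Proof.
have mw : measurable_fun (`[0, 1]%classic : set R) w.
  exact: subspace_continuous_measurable_fun.
have mF : measurable_fun setT (cdfR Y).
  exact: nondecreasing_measurable (cdfR_nondecreasing P Y).
have F01 : range (cdfR Y) `<=` (`[0, 1]%classic : set R).
  by move=> _ [y _ <-] /=; rewrite in_itv/=; exact: cdfR_in01.
exact: (measurable_comp (measurable_itv _) F01 mw mF).
Qed.

Lemma wcdf_bounded : exists M, forall y, `|w (cdfR Y y)| <= M.
Proof.
have [M HM] := within_itv_bounded w 0 1 ler01 cw.
by exists M => y; apply: HM; rewrite in_itv/=; exact: cdfR_in01.
Qed.

Hypothesis indY : forall i j, i != j -> indep_rv P (YS i) (YS j).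
Hypothesis lawY : forall i, same_law P (YS i) Y.

Lemma ae_zhat_unif : {ae P, forall t, forall e, 0 < e -> \forall n \near \oo,
  forall k, (k < n)%N ->
    `|zhat w (fun i => YS i) n t k - w (cdfR Y (YS k t))| <= e}.
Proof.
have := glivenko_cantelli P Y YS indY lawY.
apply: filterS => t GC e e0.
have [r r0 wr] := within_itv_unif_continuous w 0 1 e e0 cw.
(* One third for Glivenko-Cantelli and one for the normalisation by n + 1 keep the distance strictly
   below [r]. *)
have r30 : 0 < r / 3 by rewrite divr_gt0.
have [N _ HN] := GC _ r30.
exists (maxn N (Num.truncn (r / 3)^-1)) => // n /=; rewrite geq_max => /andP[Nn rn] k _.
rewrite /zhat; apply: wr; rewrite ?in_itv/= ?Fhat_in01 ?cdfR_in01//.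
have h1 := HN n Nn (YS k t).
have h2 := Fhat_freq_dist (fun i => YS i) n (YS k t) t.
have h3 : n.+1%:R^-1 <= r / 3.
  rewrite invf_ple ?posrE ?ltr0n//; apply/ltW; apply: lt_le_trans (truncnS_gt _) _.
  by rewrite ler_nat.
apply: (le_lt_trans (ler_distD (freq (fun i => YS i t) n `]-oo, YS k t]) _ _)).
apply: (le_lt_trans (lerD (le_trans h2 h3) h1)); lra.
Qed.

End plug_in.

Theorem theorem1 (d : measure_display) (T : measurableType d) (R : realType)
  (P : probability T R) (X Y : {RV P >-> R}) (XS YS : nat -> {RV P >-> R})
  (w : R -> R) :
  (* (X_i, Y_i) are independent copies of (X, Y) *)
  mutually_independent_pairs P (fun i => XS i) (fun i => YS i) ->
  (forall i, same_joint_law P (XS i) (YS i) X Y) ->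
  (* E[X], E[Y^2], E[XY] finite *)
  P.-integrable setT (fun t => (X t)%:E) ->
  P.-integrable setT (fun t => (Y t ^+ 2)%:E) ->
  P.-integrable setT (fun t => (X t * Y t)%:E) ->
  (* w continuous on [0,1] *)
  {within `[0, 1], continuous w} ->
  (* standing assumptions *)
  ('V_P[Y] \is a fin_num)%E -> (0 < 'V_P[Y])%E ->
  (covariance P Y (wFY w Y) \is a fin_num)%E ->
  covariance P Y (wFY w Y) != 0%E ->
  {ae P, forall t,
     (fun n => Delta_hat w (fun i => XS i) (fun i => YS i) n t) @ \oo
       --> Delta w X Y}.
Proof.
move=> ind law iX iYsq iXY cw fV V0 fC C0.
have mFST : measurable_fun setT (fst : R * R -> R) by exact: measurable_fst.
have mSND : measurable_fun setT (snd : R * R -> R) by exact: measurable_snd.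
have iYY : P.-integrable setT (fun t => (Y t * Y t)%:E).
  by under eq_fun do rewrite -expr2.
have icst : P.-integrable setT (EFin \o cst 1).
  exact: finite_measure_integrable_cst.
have iY : P.-integrable setT (fun t => (Y t)%:E).
  (* |Y| <= 1 + Y^2. *)
  apply: (@le_integrable _ _ _ P setT measurableT _
    (fun t => (1%R)%:E + (Y t ^+ 2)%:E)%E).
  - exact/measurable_EFinP.
  - move=> t _; rewrite -EFinD !abse_EFin lee_fin [leRHS]ger0_norm; last first.
      by rewrite addr_ge0// sqr_ge0.
    rewrite ler_norml; apply/andP; split; nra.
  - exact: integrableD.
have mwF := measurable_wcdf P Y w cw.
have [M wM] := wcdf_bounded P Y w cw.
have mwFY : measurable_fun setT (wFY w Y).
  exact: (measurableT_comp mwF).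
have wFYM t : `|wFY w Y t| <= M by exact: wM.
have iXw := integrableM_bounded P X (wFY w Y) M mwFY wFYM iX.
have iYw := integrableM_bounded P Y (wFY w Y) M mwFY wFYM iY.
have iw : P.-integrable setT (EFin \o wFY w Y).
  have := integrableM_bounded P (cst 1) (wFY w Y) M mwFY wFYM icst.
  by under eq_fun do rewrite mul1r.
have inorm (U : T -> R) : P.-integrable setT (EFin \o U) ->
    P.-integrable setT (fun t => (`|U t|)%:E).
  exact: integrable_abse.
have mnorm := @normr_measurable R setT.
have SL := slln_pair P X Y XS YS ind law.
have indY i j : i != j -> indep_rv P (YS i) (YS j).
  exact: (pairwise_indep P XS YS ind snd).
have lawY i : same_law P (YS i) Y.
  move=> A mA; apply: (law i (snd @^-1` A)).
  by rewrite -(setTI (_ @^-1` _)); exact: mSND.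
have mwS : measurable_fun setT (fun p : R * R => w (cdfR Y p.2)).
  exact: (measurableT_comp mwF).
have aeX := SL fst mFST iX.
have aeY := SL snd mSND iY.
have aeZ := SL (fun p => w (cdfR Y p.2)) mwS iw.
have aeXY := SL (fun p => p.1 * p.2) (measurable_funM mFST mSND) iXY.
have aeYY := SL (fun p => p.2 * p.2) (measurable_funM mSND mSND) iYY.
have aeXZ := SL (fun p => p.1 * w (cdfR Y p.2)) (measurable_funM mFST mwS) iXw.
have aeYZ := SL (fun p => p.2 * w (cdfR Y p.2)) (measurable_funM mSND mwS) iYw.
have aeNX := SL (fun p => `|p.1|) (measurableT_comp mnorm mFST) (inorm _ iX).
have aeNY := SL (fun p => `|p.2|) (measurableT_comp mnorm mSND) (inorm _ iY).
have aeU := ae_zhat_unif P Y YS w cw indY lawY.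
have aeI (A B : T -> Prop) : {ae P, forall t, A t} -> {ae P, forall t, B t} ->
    {ae P, forall t, A t /\ B t}.
  by apply: filterS2 => t.
have := aeI _ _ aeU (aeI _ _ aeX (aeI _ _ aeY (aeI _ _ aeZ (aeI _ _ aeXY
  (aeI _ _ aeYY (aeI _ _ aeXZ (aeI _ _ aeYZ (aeI _ _ aeNX aeNY)))))))).
apply: filterS => t [U [cX [cY [cZ [cXY [cYY [cXZ [cYZ [cNX cNY]]]]]]]]].
have zX := smean_perturb _ _ _ _ _ cXZ cNX U.
have zY := smean_perturb _ _ _ _ _ cYZ cNY U.
have zZ : (fun n => smean n (zhat w (fun i => YS i) n t)) @ \oo --> fine 'E_P[wFY w Y].
  have smean1 n : smean n (fun k => 1 * zhat w (fun i => YS i) n t k) =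
      smean n (zhat w (fun i => YS i) n t).
    by congr (smean n _); apply/funext => k; rewrite mul1r.
  under eq_fun do rewrite -smean1.
  (* The mean of the [zhat] values is the case of constant weights 1; their own mean is 1 only from
     n = 1 on. *)
  apply: (@smean_perturb _ (cst 1) _ _ _ 1 _ _ U).
    by under eq_fun do under eq_fun do rewrite mul1r.
  apply/cvgrPdist_le => e e0; exists 1%N => // n /= n0.
  rewrite /smean; under eq_bigr do rewrite normr1.
  by rewrite sumr_const card_ord mulVf ?subrr ?normr0 ?ltW// pnatr_eq0 -lt0n.
have covXZ := fine_covarianceE P X (wFY w Y) iX iw iXw.
have covYZ := fine_covarianceE P Y (wFY w Y) iY iw iYw.
have covXY := fine_covarianceE P X Y iX iY iXY.
have covYY := fine_covarianceE P Y Y iY iY iYY.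
have C0' : fine (covariance P Y (wFY w Y)) != 0.
  by apply: contra C0 => /eqP h; rewrite -(fineK fC) h.
have V0' : fine (variance P Y) != 0.
  by rewrite gt_eqF// -lte_fin fineK.
rewrite /Delta /beta_G /beta_cl.
under eq_fun do rewrite /Delta_hat betaG_hatE beta_hatE.
(* Each ratio converges since its denominator has a nonzero limit, by [C0'] and [V0']; four sample
   covariances remain. *)
apply: cvgB; (apply: cvgM; last (apply: cvgV => //)).
- by rewrite covXZ; apply: cvgB => //; exact: cvgM.
- by rewrite covYZ; apply: cvgB => //; exact: cvgM.
- by rewrite covXY; apply: cvgB => //; exact: cvgM.
- by rewrite /variance covYY; apply: cvgB => //; exact: cvgM.
Qed.
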